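(* Let $m$ be a positive integer. Then $$\sum_{n=0}^\infty |\Delta^m u(n)|^2 \geq \frac{1}{2^{4m}} \prod_{i=0}^{2m-1} (8m-3-4i) \sum_{n=1}^\infty \frac{|u(n)|^2}{n^{4m}}$$ for all finitely supported $u:\mathbb{N}_0\to\mathbb{R}$ with $u(i)=0$ for $0\leq i \leq 2m-1$, and $$\sum_{n=1}^\infty |D(\Delta^m u)(n)|^2 \geq \frac{1}{2^{4m+2}} \prod_{i=0}^{2m} (8m+1-4i) \sum_{n=1}^\infty \frac{|u(n)|^2}{n^{4m+2}}$$ for all finitely supported $u:\mathbb{N}_0\to\mathbb{R}$ with $u(i)=0$ for $0\leq i \leq 2m$.
   Context: $\mathbb{N}_0=\{0,1,2,\dots\}$. For $u:\mathbb{N}_0\to\mathbb{R}$, the first order difference operator on $\mathbb{N}_0$ is $Du(n):=u(n)-u(n-1)$ for $n\ge 1$. The second order difference operator (Laplacian) on $\mathbb{N}_0$ is $\Delta u(n):=2u(n)-u(n-1)-u(n+1)$ for $n\geq 1$, and $\Delta u(0):=u(0)-u(1)$. $\Delta^m$ denotes the $m$-fold composition of $\Delta$. *)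

(* Defs.v *)
From mathcomp Require Import all_boot all_order all_algebra.
From mathcomp Require Import all_classical all_reals all_analysis.

Set Implicit Arguments.
Unset Strict Implicit.
Unset Printing Implicit Defensive.

Import Order.TTheory GRing.Theory Num.Theory.

Local Open Scope classical_set_scope.
Local Open Scope ring_scope.

(* Only meaningful for n >= 1: the value [diff1 u 0 = 0] is a junk value,
   since [0.-1 = 0]. *)
Definition diff1 (R : realType) (u : nat -> R) (n : nat) : R :=
  u n - u n.-1.

Definition laplacian (R : realType) (u : nat -> R) (n : nat) : R :=
  if n is k.+1 then 2 * u k.+1 - u k - u k.+2 else u 0%N - u 1%N.

Definition finitely_supported (R : realType) (u : nat -> R) : Prop :=
  finite_set [set n | u n != 0].

(* Main.v *)
Require Import Defs.
From mathcomp Require Import all_boot all_order all_algebra.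
From mathcomp Require Import all_classical all_reals all_analysis.
From mathcomp Require Import ring lra zify.

(** The powers of the Laplacian are, up to sign and translation, powers of the
    backward difference [D]: if [u] vanishes on [0, 2m) then
    [Delta^m u (n) = (-1)^m D^(2m) u (n + m)], the boundary rule for [Delta] at
    [0] being consistent because the relevant values of [u] are zero there
    ([iter_laplacian_diff1]). Both inequalities thereby become the single bound
      [c_0 c_1 ... c_(K-1) * sum u(n)^2 / n^(2K) <= sum (D^K u (n))^2],
    with [c_k = (4k + 1) / 4], for [K = 2m] and [K = 2m + 1]; reversing the
    product gives the stated constants ([prod_hardy_constants]).

    The bound follows by composing [K] weighted Hardy inequalities
      [c_k * sum v(n)^2 / n^(2k+2) <= sum (D v (n))^2 / n^(2k)],
    each for [v] vanishing on [0, k] ([power_weighted_hardy]). The [k]-th one is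
    proved with a positive test sequence [phi]: the pointwise inequality
      [(v(n) - v(n-1))^2 >= (1 - phi(n-1)/phi(n)) v(n)^2
                            - (phi(n)/phi(n-1) - 1) v(n-1)^2]
    is multiplied by the weight and summed by parts ([hardy_of_riccati]). The
    choice of [phi] is what makes the verification rational. For [k = 0] it is
    the sequence with ratios [phi(n+1)/phi(n) = (4n + 3)/(4n + 1)], which mimics
    [sqrt n] and yields the sharp [1/4]. For [k >= 1] the constant [c_k] is
    strictly below the continuous one, [(2k + 1)^2 / 4], and the linear
    [phi(n) = n - k] suffices.

    The summation by parts leaves a nonnegative boundary term, so every
    inequality holds for partial sums and passes to the series directly. *)

Set Implicit Arguments.
Unset Strict Implicit.
Unset Printing Implicit Defensive.

Import Order.TTheory GRing.Theory Num.Theory.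

Local Open Scope classical_set_scope.
Local Open Scope ring_scope.

(** * Weighted Hardy inequalities *)

(** The difference of the two sides, multiplied by [1 + b], is at least the
    square [(x - (1 + b) y)^2]. With [1 + b = phi(n+1)/phi(n)] and
    [1 - a = phi(n)/phi(n+1)] the second hypothesis is an equality. *)
Lemma sqr_sub_ge (R : realType) (a b x y : R) :
  0 <= b -> 1 <= (1 - a) * (1 + b) ->
  a * x ^+ 2 - b * y ^+ 2 <= (x - y) ^+ 2.
Proof.
move=> b0 hab; have b1 : 0 < 1 + b by lra.
rewrite -subr_ge0 -(pmulr_rge0 _ b1).
have -> : (1 + b) * ((x - y) ^+ 2 - (a * x ^+ 2 - b * y ^+ 2)) =
  (x - (1 + b) * y) ^+ 2 + ((1 - a) * (1 + b) - 1) * x ^+ 2 by ring.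
by rewrite addr_ge0 ?sqr_ge0 // mulr_ge0 ?sqr_ge0 // subr_ge0.
Qed.

(** Summation by parts against a test sequence [phi], encoded by its relative
    increments [a n = 1 - phi(n-1)/phi(n)] and [b n = phi(n+1)/phi(n) - 1] so
    that [phi], which may only be known through its ratios, never appears. At
    [n = k + 1] the previous value of [v] is zero, so [a k.+1] may be as large
    as [1], which corresponds to [phi k = 0]. *)
Lemma hardy_of_riccati (R : realType) (k : nat) (w g a b v : nat -> R) :
  (forall n, 0 <= w n) ->
  (forall n, (k < n)%N -> 0 <= b n) ->
  a k.+1 <= 1 ->
  (forall n, (k < n)%N -> 1 <= (1 - a n.+1) * (1 + b n)) ->
  (forall n, (k < n)%N -> g n + w n.+1 * b n <= w n * a n) ->
  (forall i, (i <= k)%N -> v i = 0) ->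
  forall N, \sum_(1 <= n < N.+1) g n * v n ^+ 2
    <= \sum_(1 <= n < N.+1) w n * diff1 v n ^+ 2.
Proof.
move=> w0 b0 ak hab hg v0 N.
(* The extra term is the boundary term of the summation by parts. *)
suff H : \sum_(1 <= n < N.+1) g n * v n ^+ 2 + w N.+1 * b N * v N ^+ 2
    <= \sum_(1 <= n < N.+1) w n * diff1 v n ^+ 2.
  apply: le_trans H; rewrite lerDl.
  case: (leqP N k) => hN; first by rewrite v0 // expr0n mulr0.
  by rewrite mulr_ge0 ?sqr_ge0 // mulr_ge0 ?w0 ?b0.
elim: N => [|N IH]; first by rewrite !big_geq // v0 // expr0n mulr0 addr0.
rewrite big_nat_recr //= [in leRHS]big_nat_recr //= /diff1 /=.
case: (leqP N.+1 k) => hN.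
  rewrite (v0 N.+1) // (v0 N (ltnW hN)) subrr expr0n !mulr0 !addr0.
  by move: IH; rewrite (v0 N (ltnW hN)) expr0n mulr0 addr0.
have gN := ler_wpM2r (sqr_ge0 (v N.+1)) (hg _ hN).
suff K : a N.+1 * v N.+1 ^+ 2 - b N * v N ^+ 2 <= (v N.+1 - v N) ^+ 2.
  have := ler_wpM2l (w0 N.+1) K; rewrite /diff1 in IH; lra.
case: (ltnP k N) => hkN; first exact: sqr_sub_ge (b0 _ hkN) (hab _ hkN).
have eN : N = k by apply/eqP; rewrite eqn_leq hkN -ltnS.
rewrite (v0 N) // eN expr0n mulr0 !subr0.
by rewrite -[leRHS]mul1r ler_wpM2r ?sqr_ge0.
Qed.

(** The classical discrete Hardy inequality. The ratios [(4n + 3)/(4n + 1)]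
    agree with those of [sqrt n] up to second order, and give
    [a n - b n = 4 / (16 n^2 - 1)], just above [1 / (4 n^2)]. *)
Lemma hardy_inequality (R : realType) (v : nat -> R) : v 0%N = 0 ->
  forall N, 4^-1 * \sum_(1 <= n < N.+1) v n ^+ 2 / n%:R ^+ 2
    <= \sum_(1 <= n < N.+1) diff1 v n ^+ 2.
Proof.
move=> v0 N.
have := @hardy_of_riccati R 0 (fun=> 1) (fun n => 4^-1 / n%:R ^+ 2)
  (fun n => 2 / (4 * n%:R - 1)) (fun n => 2 / (4 * n%:R + 1)) v.
move=> /(_ _ _ _ _ _ _ N) H.
rewrite mulr_sumr.
under eq_bigr do rewrite mulrCA mulrC.
under [leRHS]eq_bigr do rewrite -[_ ^+ 2]mul1r.
apply: H => //.
- by rewrite ler_pdivrMr; lra.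
- move=> n n0; have hn : 1 <= n%:R :> R by rewrite ler1n.
  rewrite -(natr1 n) le_eqVlt; apply/orP; left; apply/eqP; field.
  by apply/andP; split; lra.
- move=> n n0; have hn : 1 <= n%:R :> R by rewrite ler1n.
  rewrite !mul1r -subr_ge0.
  have -> : 2 / (4 * n%:R - 1) - (4^-1 / n%:R ^+ 2 + 2 / (4 * n%:R + 1)) =
    ((4 * n%:R - 1) * (4 * n%:R + 1) * (4 * n%:R ^+ 2))^-1 :> R.
    by field; repeat (apply/andP; split); lra.
  by rewrite invr_ge0 !mulr_ge0 ?sqr_ge0 //; lra.
- by move=> [|].
Qed.

(** Bernoulli's inequality [1 + q / x <= (1 + 1 / x)^q] with denominators
    cleared. *)
Lemma bernoulli_cross (R : realType) (x : R) (q : nat) : 0 <= x ->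
  (x + q%:R) * x ^+ q <= x * (x + 1) ^+ q.
Proof.
move=> x0; elim: q => [|q IH]; first by rewrite addr0 !expr0.
have q0 : 0 <= q%:R :> R by [].
have xq : 0 <= x ^+ q by rewrite exprn_ge0.
have x1 : 0 <= x + 1 by lra.
have := ler_wpM2l x1 IH; rewrite !exprS -natr1.
have := mulr_ge0 q0 xq; lra.
Qed.

(** The condition on [phi(n) = n - k]. By Bernoulli the relative decrease of
    the weight [n^(-2k)] is at least [2k / (n + 2k)], which reduces the claim to
    [(4k + 1) (n - k) (n + 2k) <= 8 k n^2]; this holds since
    [(n - k) (n + 2k)] is at most [9 n^2 / 8], its value at [n = 4k]. *)
Lemma hardy_weight_gap (R : realType) (k n : nat) : (0 < k < n)%N ->
  (4 * k%:R + 1) / 4 / n%:R ^+ (2 * k.+1) + (n.+1%:R ^+ (2 * k))^-1 / (n%:R - k%:R)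
  <= (n%:R ^+ (2 * k))^-1 / (n%:R - k%:R) :> R.
Proof.
move=> /andP[k0 kn].
have hk : 1 <= k%:R :> R by rewrite ler1n.
have hn : k%:R + 1 <= n%:R :> R by rewrite natr1 ler_nat.
set x : R := n%:R in hn *; set y : R := k%:R in hk hn *.
have x0 : 0 < x by lra.
have d0 : 0 < x - y by lra.
have s0 : 0 < x + 2 * y by lra.
have p0 : 0 < x ^+ (2 * k) by rewrite exprn_gt0.
have p1 : 0 < (x + 1) ^+ (2 * k) by rewrite exprn_gt0 //; lra.
have -> : n.+1%:R = x + 1 by rewrite natr1.
have B : ((x + 1) ^+ (2 * k))^-1 <= x / (x + 2 * y) * (x ^+ (2 * k))^-1.
  have := @bernoulli_cross R x (2 * k) (ltW x0); rewrite natrM -/y => B.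
  rewrite -[leLHS]mul1r ler_pdivrMr // mulrAC ler_pdivlMr // mulrAC.
  by rewrite ler_pdivlMr // mul1r mulrC.
rewrite -lerBrDr -mulrBl ler_pdivlMr //.
apply: (@le_trans _ _ ((1 - x / (x + 2 * y)) * (x ^+ (2 * k))^-1)); last first.
  by rewrite mulrBl mul1r lerB.
have -> : x ^+ (2 * k.+1) = x ^+ 2 * x ^+ (2 * k) by rewrite mulnS exprD.
rewrite invfM mulrA mulrAC ler_wpM2r ?invr_ge0 ?(ltW p0) // -subr_ge0.
have -> : 1 - x / (x + 2 * y) - (4 * y + 1) / 4 / x ^+ 2 * (x - y) =
  (8 * y * x ^+ 2 - (4 * y + 1) * (x - y) * (x + 2 * y)) / (4 * x ^+ 2 * (x + 2 * y)).
  by field; apply/andP; split; lra.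
apply: divr_ge0; last by rewrite mulr_ge0 ?(ltW s0) // mulr_ge0 ?sqr_ge0.
have -> : 8 * y * x ^+ 2 - (4 * y + 1) * (x - y) * (x + 2 * y) =
  (4 * y + 1) * (2 * (y - x / 4) ^+ 2) + (28 * y - 9) / 8 * x ^+ 2 by field.
have q1 := sqr_ge0 (y - x / 4); have q2 := sqr_ge0 x.
by rewrite addr_ge0 // mulr_ge0 //; lra.
Qed.

Lemma power_weighted_hardy (R : realType) (k : nat) (v : nat -> R) :
  (forall i, (i <= k)%N -> v i = 0) ->
  forall N, (4 * k%:R + 1) / 4 *
      \sum_(1 <= n < N.+1) v n ^+ 2 / n%:R ^+ (2 * k.+1)
    <= \sum_(1 <= n < N.+1) diff1 v n ^+ 2 / n%:R ^+ (2 * k).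
Proof.
case: k => [|k] v0 N.
  rewrite mulr0 add0r div1r muln0.
  under [leRHS]eq_bigr do rewrite expr0 divr1.
  exact: hardy_inequality (v0 _ (leqnn _)) N.
have := @hardy_of_riccati R k.+1 (fun n => (n%:R ^+ (2 * k.+1))^-1)
  (fun n => (4 * k.+1%:R + 1) / 4 / n%:R ^+ (2 * k.+2))
  (fun n => (n%:R - k.+1%:R)^-1) (fun n => (n%:R - k.+1%:R)^-1) v.
move=> /(_ _ _ _ _ _ v0 N) H.
rewrite mulr_sumr.
under eq_bigr do rewrite mulrCA mulrC.
under [leRHS]eq_bigr do rewrite mulrC.
apply: H => //.
- by move=> n kn; rewrite invr_ge0 subr_ge0 ler_nat ltnW.
- by rewrite -[k.+2%:R]natr1 addrAC subrr add0r invr1.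
- move=> n kn; have : k.+1%:R + 1 <= n%:R :> R by rewrite natr1 ler_nat.
  rewrite -[n.+1%:R]natr1 => hn.
  rewrite le_eqVlt; apply/orP; left; apply/eqP; field.
  by apply/andP; split; lra.
- by move=> n kn; exact: hardy_weight_gap.
Qed.

(** * Iterated differences *)

(** The exponent of the weight drops by [2] with each difference taken, so the
    first inequality applied, to [v] itself, is the one with [k = K - 1]. It needs
    vanishing on all of [0, K); the backward difference keeps that vanishing,
    and the later inequalities ask for less. *)
Lemma iterated_hardy (R : realType) (K : nat) (v : nat -> R) :
  (forall i, (i < K)%N -> v i = 0) ->
  forall N, (\prod_(j < K) ((4 * j%:R + 1) / 4)) *
      \sum_(1 <= n < N.+1) v n ^+ 2 / n%:R ^+ (2 * K)
    <= \sum_(1 <= n < N.+1) iter K (@diff1 R) v n ^+ 2.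
Proof.
move=> + N; elim: K v => [|K IH] v v0.
  rewrite big_ord0 mul1r muln0 /=.
  by under eq_bigr do rewrite expr0 divr1.
rewrite iterSr big_ord_recr /= -mulrA.
apply: le_trans (IH _ _).
  apply: ler_wpM2l; last exact: power_weighted_hardy.
  by apply: prodr_ge0 => j _; rewrite divr_ge0 // addr_ge0 // mulr_ge0.
by move=> i iK; rewrite /diff1 !v0 ?subrr //; lia.
Qed.

Lemma iter_diff1_eq0 (R : realType) (K k : nat) (u : nat -> R) :
  (forall i, (i < K)%N -> u i = 0) ->
  forall i, (i < K)%N -> iter k (@diff1 R) u i = 0.
Proof.
move=> u0; elim: k => [|k IH] i iK //=; first exact: u0.
by rewrite /diff1 !IH ?subrr //; lia.
Qed.

(** On sequences vanishing near [0] the Laplacian is minus the second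
    difference, shifted by one step. The vanishing also kills both sides at
    [n = 0], where the boundary rule could disagree with that formula. *)
Lemma iter_laplacian_diff1 (R : realType) (m : nat) (u : nat -> R) :
  (forall i, (i < 2 * m)%N -> u i = 0) ->
  forall n, iter m (@laplacian R) u n
    = (-1) ^+ m * iter (2 * m) (@diff1 R) u (n + m)%N.
Proof.
elim: m => [|m IH] u0 n; first by rewrite mul1r addn0.
have -> : (2 * m.+1 = (2 * m).+2)%N by lia.
have {}IH := IH (fun i hi => u0 i ltac:(lia)).
have f0 := iter_diff1_eq0 (2 * m) u0.
rewrite !iterS; set f := iter (2 * m) _ u in IH f0 *.
case: n => [|n]; rewrite /laplacian !IH /diff1 ?addnS /= exprS.
  by rewrite !add0n !(f0 m, f0 m.+1, f0 m.-1) ?subrr ?mulr0 ?subr0 //; lia.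
ring.
Qed.

Lemma prod_hardy_constants (R : realType) (K : nat) :
  (2 ^+ (2 * K))^-1 * \prod_(0 <= i < K) (4 * K%:R - 3 - 4 * i%:R : R)
  = \prod_(j < K) ((4 * j%:R + 1) / 4).
Proof.
rewrite big_split /= prodr_const card_ord mulrC exprM -natrX exprVn.
congr (_ / _); rewrite big_nat_rev add0n big_mkord.
apply: eq_bigr => j _; rewrite natrB -?natr1 //; ring.
Qed.

(** * Passage to series *)

Lemma nneseries_le_of_partial (R : realType) (C : R) (f g : nat -> R) (p q : nat) :
  0 <= C -> (forall n, 0 <= f n) -> (forall n, 0 <= g n) ->
  (forall N, exists M, C * \sum_(p <= n < N) g n <= \sum_(q <= n < M) f n) ->
  (C%:E * \sum_(p <= n <oo) (g n)%:E <= \sum_(q <= n <oo) (f n)%:E)%E.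
Proof.
move=> C0 f0 g0 H.
rewrite -nneseriesZl; last by move=> i _; rewrite lee_fin.
apply: lime_le.
  by apply: is_cvg_nneseries => n _ _; rewrite mule_ge0 ?lee_fin.
apply: nearW => N; have [M HM] := H N.
apply: le_trans (nneseries_lim_ge M _); last by move=> n _ _; rewrite lee_fin.
under eq_bigr do rewrite -EFinM.
by rewrite !sumEFin lee_fin -mulr_sumr.
Qed.

(** The starting index [q] and the shift [s] accommodate both series of the
    theorem: the terms of [sum (D^K u)^2] that the shift skips, those of index
    below [q + s <= K], vanish. *)
Lemma iterated_hardy_series (R : realType) (K q : nat) (u f : nat -> R) (s : nat) :
  (forall i, (i < K)%N -> u i = 0) ->
  (q + s <= K)%N -> (0 < q + s)%N ->
  (forall n, (q <= n)%N -> f n = iter K (@diff1 R) u (n + s)%N ^+ 2) ->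
  (forall n, 0 <= f n) ->
  (((2 ^+ (2 * K))^-1 *
      \prod_(0 <= i < K) (4 * K%:R - 3 - 4 * i%:R : R))%:E *
      \sum_(1 <= n <oo) (`|u n| ^+ 2 / n%:R ^+ (2 * K))%:E
    <= \sum_(q <= n <oo) (f n)%:E)%E.
Proof.
move=> u0 qsK qs0 fE f0.
apply: nneseries_le_of_partial => //.
  rewrite prod_hardy_constants; apply: prodr_ge0 => j _.
  by rewrite divr_ge0 // addr_ge0 // mulr_ge0.
case=> [|N]; first by exists 0%N; rewrite [X in _ * X]big_geq // mulr0 big_geq.
exists (N.+1 + q)%N.
rewrite prod_hardy_constants.
under [X in _ * X <= _]eq_bigr do rewrite real_normK ?num_real //.
apply: le_trans (iterated_hardy u0 N) _.
set g := fun n => iter K (@diff1 R) u n ^+ 2.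
have -> : \sum_(q <= n < N.+1 + q) f n = \sum_(q + s <= n < N.+1 + q + s) g n.
  rewrite [RHS]big_addn addnK; apply: eq_big_nat => n /andP[qn _].
  exact: fE.
have <- : \sum_(1 <= n < N.+1 + q + s) g n
    = \sum_(q + s <= n < N.+1 + q + s) g n.
  rewrite (@big_cat_nat _ _ _ (q + s)%N) //=; last by rewrite -addnA leq_addl.
  rewrite big_nat_cond big1 ?add0r // => n /andP[/andP[_ nqs] _].
  by rewrite /g (iter_diff1_eq0 K u0) ?expr0n // (leq_trans nqs).
rewrite [leRHS](@big_cat_nat _ _ _ N.+1) //=; last by rewrite -addnA leq_addr.
by rewrite lerDl sumr_ge0 // => n _; exact: sqr_ge0.
Qed.

Theorem theorem2p3 (R : realType) (m : nat) (hm : (0 < m)%N) :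
  (forall u : nat -> R, finitely_supported u ->
     (forall i : nat, (i <= 2 * m - 1)%N -> u i = 0) ->
     (((2 ^+ (4 * m))^-1 *
        \prod_(0 <= i < 2 * m) (8 * m%:R - 3 - 4 * i%:R : R))%:E *
        \sum_(1 <= n <oo) (`|u n| ^+ 2 / n%:R ^+ (4 * m))%:E
      <= \sum_(0 <= n <oo) (`|iter m (@laplacian R) u n| ^+ 2)%:E)%E)
  /\
  (forall u : nat -> R, finitely_supported u ->
     (forall i : nat, (i <= 2 * m)%N -> u i = 0) ->
     (((2 ^+ (4 * m + 2))^-1 *
        \prod_(0 <= i < (2 * m).+1) (8 * m%:R + 1 - 4 * i%:R : R))%:E *
        \sum_(1 <= n <oo) (`|u n| ^+ 2 / n%:R ^+ (4 * m + 2))%:E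
      <= \sum_(1 <= n <oo)
           (`|diff1 (iter m (@laplacian R) u) n| ^+ 2)%:E)%E).
Proof.
split=> u _ u0.
- have u0' i : (i < 2 * m)%N -> u i = 0 by move=> hi; apply: u0; lia.
  have -> : (4 * m = 2 * (2 * m))%N by lia.
  under eq_bigr => i _.
    have -> : 8 * m%:R - 3 - 4 * i%:R = 4 * (2 * m)%:R - 3 - 4 * i%:R :> R.
      by rewrite natrM; ring.
    over.
  apply: (iterated_hardy_series (s := m) u0') => [||n _|n];
    rewrite ?add0n ?exprn_ge0 //.
    by rewrite leq_pmull.
  rewrite iter_laplacian_diff1 // real_normK ?num_real //.
  by rewrite exprMn sqrr_sign mul1r.
- have u0' i : (i < 2 * m)%N -> u i = 0 by move=> hi; apply: u0; lia.
  have -> : (4 * m + 2 = 2 * (2 * m).+1)%N by lia.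
  under eq_bigr => i _.
    have -> : 8 * m%:R + 1 - 4 * i%:R = 4 * (2 * m).+1%:R - 3 - 4 * i%:R :> R.
      by rewrite -(natr1 (2 * m)) natrM; ring.
    over.
  apply: (iterated_hardy_series (K := (2 * m).+1) (s := m) u0) => [||n n1|n];
    rewrite ?exprn_ge0 //.
    by rewrite add1n ltnS leq_pmull.
  rewrite real_normK ?num_real // /diff1 !iter_laplacian_diff1 // -mulrBr.
  rewrite exprMn sqrr_sign mul1r /= /diff1.
  by case: n n1.
Qed.
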